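(* For every power network with bus shunts, line charging and transformers (data as specified in the context), the models (CDF-E-PF) and (SOC-E-PF) defined in the context are equivalent. That is, there is a bijection between the set of feasible solutions $\big((S^g_i)_{i\in N},(W_i)_{i\in N},(L_{ij})_{(i,j)\in E},(S_{ij})_{(i,j)\in E\cup E^R}\big)$ of (CDF-E-PF) and the set of feasible solutions $\big((S^g_i)_{i\in N},(W_i)_{i\in N},(W_{ij})_{(i,j)\in E},(S_{ij})_{(i,j)\in E\cup E^R}\big)$ of (SOC-E-PF) which leaves the values of the shared variables $S^g_i$, $W_i$, $S_{ij}$ unchanged.
   Context: **Network and data.** $N$ is a finite set of buses. $E$ is a finite set of directed arcs $(i,j)$ with $i,j\in N$, one arc per line, each line being given a single orientation. $E^R=\{(j,i):(i,j)\in E\}$ is the set of reversed arcs. $X^*$ denotes complex conjugation, and $\Re$, $\Im$ denote real and imaginary parts. The following constants are given. - For each $i\in N$: a complex demand $S^d_i$; complex generation bounds $S^{gl}_i,S^{gu}_i$; a complex bus shunt admittance $Y^s_i$; real voltage magnitude bounds $v^l_i,v^u_i\ge 0$. - For each $(i,j)\in E$: a nonzero complex line admittance $Y_{ij}$, with impedance $Z_{ij}=1/Y_{ij}$; complex line charging values $Y^c_{ij}$ and $Y^c_{ji}$ (possibly different); a nonzero complex transformer parameter $T_{ij}$; a voltage angle difference bound $\theta^\Delta_{ij}\in[0,\pi/2)$. - For each $(i,j)\in E\cup E^R$: a real thermal limit $s^u_{ij}$. Inequalities between complex numbers, such as $S^{gl}_i\le S^g_i\le S^{gu}_i$, are meant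 separately for real and imaginary parts. $Y^{c*}_{ij}$ means $(Y^c_{ij})^*$. **Shared variables.** $S^g_i\in\mathbb{C}$ and $W_i\in\mathbb{R}$ for $i\in N$; $S_{ij}\in\mathbb{C}$ for $(i,j)\in E\cup E^R$. **Shared constraints.** $$S^{gl}_i\le S^g_i\le S^{gu}_i\quad\forall i\in N,\qquad |S_{ij}|\le s^u_{ij}\quad\forall (i,j)\in E\cup E^R,\qquad (v^l_i)^2\le W_i\le (v^u_i)^2\quad\forall i\in N,$$ $$S^g_i-S^d_i-(Y^s_i)^*W_i=\sum_{j:\,(i,j)\in E\cup E^R}S_{ij}\quad\forall i\in N.$$ **Model (SOC-E-PF).** The variables are the shared variables together with $W_{ij}\in\mathbb{C}$ for $(i,j)\in E$. The constraints are the shared constraints together with, for all $(i,j)\in E$: $$\tan(-\theta^\Delta_{ij})\,\Re(W_{ij})\le \Im(W_{ij})\le \tan(\theta^\Delta_{ij})\,\Re(W_{ij}),$$ $$S_{ij}=(Y_{ij}+Y^c_{ij})^*\frac{W_i}{|T_{ij}|^2}-Y_{ij}^*\frac{W_{ij}}{T_{ij}},\qquad S_{ji}=(Y_{ij}+Y^c_{ji})^*W_j-Y_{ij}^*\frac{W_{ij}^*}{T_{ij}^*},$$ $$|W_{ij}|^2\le W_iW_j .$$ **Model (CDF-E-PF).** The variables are the shared variables together with $L_{ij}\in\mathbb{R}$ for $(i,j)\in E$. The constraints are the shared constraints together with, for all $(i,j)\in E$: $$\tan(-\theta^\Delta_{ij})\,\Re(A_{ij})\le\Im(A_{ij})\le\tan(\theta^\Delta_{ij})\,\Re(A_{ij}),\quad\text{where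 } A_{ij}=Z_{ij}^*T_{ij}\Big((Y_{ij}+Y^c_{ij})^*\frac{W_i}{|T_{ij}|^2}-S_{ij}\Big),$$ $$S_{ij}+S_{ji}=Z_{ij}\Big(L_{ij}-Y^c_{ij}S_{ij}-Y^{c*}_{ij}S_{ij}^*+|Y^c_{ij}|^2\frac{W_i}{|T_{ij}|^2}\Big)+Y^{c*}_{ij}\frac{W_i}{|T_{ij}|^2}+Y^{c*}_{ji}W_j,$$ $$\big(1+Z_{ij}Y^c_{ij}+Z_{ij}^*Y^{c*}_{ij}\big)\frac{W_i}{|T_{ij}|^2}-W_j=\big(Z_{ij}^*S_{ij}+Z_{ij}S_{ij}^*\big)-|Z_{ij}|^2\Big(L_{ij}-Y^c_{ij}S_{ij}-Y^{c*}_{ij}S_{ij}^*+|Y^c_{ij}|^2\frac{W_i}{|T_{ij}|^2}\Big),$$ $$|S_{ij}|^2\le\frac{W_i}{|T_{ij}|^2}L_{ij}.$$ *)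

(* Defs.v *)
From HB Require Import structures.
From mathcomp Require Import all_boot all_order all_algebra.
From mathcomp Require Import all_classical all_reals all_analysis.
From mathcomp Require Export complex.

Set Implicit Arguments.
Unset Strict Implicit.
Unset Printing Implicit Defensive.

Import Order.TTheory GRing.Theory Num.Theory.

Local Open Scope ring_scope.
Local Open Scope complex_scope.

Section Arcs.
Variables (N : finType) (E : {set N * N}).

Definition reversed : {set N * N} := [set (e.2, e.1) | e in E].

Definition line := {e : N * N | e \in E}.

Definition darc := {a : N * N | a \in E :|: reversed}.

Lemma fwd_subproof (e : line) : val e \in E :|: reversed.
Proof. by rewrite inE (valP e). Qed.

Lemma bwd_subproof (e : line) :
  ((val e).2, (val e).1) \in E :|: reversed.
Proof. by rewrite inE; apply/orP; right; apply: imset_f; apply: valP. Qed.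

(* For a line (i, j) in E, [fwd] is the arc (i, j) and [bwd] the arc (j, i). *)
Definition fwd (e : line) : darc := exist _ (val e) (fwd_subproof e).
Definition bwd (e : line) : darc :=
  exist _ ((val e).2, (val e).1) (bwd_subproof e).

End Arcs.

(* The order of R[i] compares only numbers with equal imaginary parts, hence
   the separate componentwise order. *)
Definition cle (R : realType) (x y : R[i]) : Prop :=
  (complex.Re x <= complex.Re y) /\ (complex.Im x <= complex.Im y).

(* [lines_oriented]: a line is listed in one direction only; a loop (i, i) is its
   own reversal and is not excluded. *)
Record network (R : realType) (N : finType) := Network {
  lines : {set N * N};
  lines_oriented : forall i j,
    (i, j) \in lines -> (j, i) \in lines -> i = j;
  demand : N -> R[i];
  gen_lo : N -> R[i];
  gen_up : N -> R[i];
  shunt : N -> R[i];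
  volt_lo : N -> R;
  volt_up : N -> R;
  volt_lo_ge0 : forall i, 0 <= volt_lo i;
  volt_up_ge0 : forall i, 0 <= volt_up i;
  admittance : line lines -> R[i];
  admittance_neq0 : forall e, admittance e != 0;
  charging : darc lines -> R[i];
  transformer : line lines -> R[i];
  transformer_neq0 : forall e, transformer e != 0;
  angle_bound : line lines -> R;
  angle_bound_ge0 : forall e, 0 <= angle_bound e;
  angle_bound_lt : forall e, angle_bound e < pi / 2;
  thermal : darc lines -> R
}.

Section Models.
Variables (R : realType) (N : finType) (D : network R N).

Local Notation line := (line (lines D)).
Local Notation darc := (darc (lines D)).

Record shared_vars := SharedVars {
  Sg : {ffun N -> R[i]};
  W : {ffun N -> R};
  Sf : {ffun darc -> R[i]}
}.

Record cdf_vars := CdfVars {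
  cdf_shared : shared_vars;
  L : {ffun line -> R}
}.

Record soc_vars := SocVars {
  soc_shared : shared_vars;
  Wl : {ffun line -> R[i]}
}.

Definition impedance (e : line) : R[i] := 1 / admittance e.

(* Norms live in R[i], where `|z| is a nonnegative real; inequalities stated in
   R[i] below only ever compare real numbers. *)

(* W_i / |T_ij|^2 for the line (i, j) *)
Definition Wtap (x : shared_vars) (e : line) : R[i] :=
  (W x (val e).1)%:C / `|transformer e| ^+ 2.

Definition angle_constraint (e : line) (w : R[i]) : Prop :=
  tan (- angle_bound e) * complex.Re w <= complex.Im w /\
  complex.Im w <= tan (angle_bound e) * complex.Re w.

Definition shared_constraints (x : shared_vars) : Prop :=
  [/\ forall i, cle (gen_lo D i) (Sg x i) /\ cle (Sg x i) (gen_up D i),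
      forall a : darc, `|Sf x a| <= (thermal a)%:C,
      forall i, volt_lo D i ^+ 2 <= W x i /\ W x i <= volt_up D i ^+ 2 &
      forall i, Sg x i - demand D i - (shunt D i)^* * (W x i)%:C
                = \sum_(a : darc | (val a).1 == i) Sf x a].

Definition soc_feasible : set soc_vars := fun p =>
  let x := soc_shared p in
  shared_constraints x /\
  forall e : line,
    let Y := admittance e in
    let T := transformer e in
    let Wi := (W x (val e).1)%:C in
    let Wj := (W x (val e).2)%:C in
    let Wij := Wl p e in
    [/\ angle_constraint e Wij,
        Sf x (fwd e) = (Y + charging (fwd e))^* * Wtap x e - Y^* * (Wij / T),
        Sf x (bwd e) = (Y + charging (bwd e))^* * Wj - Y^* * (Wij^* / T^*) &
        `|Wij| ^+ 2 <= Wi * Wj].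

Definition cdf_feasible : set cdf_vars := fun p =>
  let x := cdf_shared p in
  shared_constraints x /\
  forall e : line,
    let Y := admittance e in
    let Z := impedance e in
    let T := transformer e in
    let Yc := charging (fwd e) in
    let Yc' := charging (bwd e) in
    let Vi := Wtap x e in
    let Wj := (W x (val e).2)%:C in
    let Sij := Sf x (fwd e) in
    let Sji := Sf x (bwd e) in
    let Lij := (L p e)%:C in
    [/\ angle_constraint e (Z^* * T * ((Y + Yc)^* * Vi - Sij)),
        Sij + Sji
        = Z * (Lij - Yc * Sij - Yc^* * Sij^* + `|Yc| ^+ 2 * Vi)
          + Yc^* * Vi + Yc'^* * Wj,
        (1 + Z * Yc + Z^* * Yc^*) * Vi - Wj
        = (Z^* * Sij + Z * Sij^*)
          - `|Z| ^+ 2 * (Lij - Yc * Sij - Yc^* * Sij^* + `|Yc| ^+ 2 * Vi) &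
        `|Sij| ^+ 2 <= Vi * Lij].

End Models.

(* Main.v *)
Require Import Defs.
From mathcomp Require Import all_boot all_order all_algebra.
From mathcomp Require Import all_classical all_reals all_analysis.
From mathcomp Require Import ring.

Set Implicit Arguments.
Unset Strict Implicit.
Unset Printing Implicit Defensive.

Import Order.TTheory GRing.Theory Num.Theory.

Local Open Scope ring_scope.

(** Fix one line and write V = W_i / |T|^2 for the squared voltage behind the
    transformer, Z = 1 / Y, and u = W_ij / T. The sending equation of the SOC
    model, S_ij = (Y + Yc)^* V - Y^* u, can be solved for u, because Y is
    nonzero; hence W_ij is determined by the shared variables, and it is
    exactly the quantity A_ij of the angle constraint of the CDF model. This
    value of W_ij defines the bijection.

    Now put l = L - Yc S_ij - Yc^* S_ij^* + |Yc|^2 V, which represents the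
    squared current in the series element of the line. With u expressed through
    S_ij, the voltage-drop equation of the CDF model says
      |Z|^2 l = V + W_j - u - u^*,
    the expansion of |Z I|^2 = |v_i / T - v_j|^2 (lemma voltage_drop_iff). Given
    this balance, the loss equation is equivalent to the receiving equation
    (receiving_flow_iff), and the two cone constraints are equivalent because
      V W_j - |u|^2 = |Z|^2 (V L - |S_ij|^2)
    (cone_gapE). Finally the balance has exactly one solution L, and that
    solution is real (balance_iff_current_sq, current_sq_real). So, line by line,
    the CDF constraints amount to the SOC constraints for the determined W_ij
    together with a formula for L in the shared variables (cdf_line_iff). *)

(** * Algebra of one line *)

Section SingleLine.
Variables (C : numClosedFieldType) (Y A B S S' V W L : C).
Hypotheses (Y0 : Y != 0) (V_real : V^* = V).

Local Notation Z := (1 / Y).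

(** In terms of voltages this is (v_i / T) v_j^*, the entry W_ij seen behind the
    transformer. *)
Definition voltage_product : C := Z^* * ((Y + A)^* * V - S).

(** L stands for the squared current entering behind the transformer; the part
    Yc v_i / T drawn by the line charging is subtracted from that current before
    squaring, the current itself being eliminated through S. *)
Definition series_current_sq : C :=
  L - A * S - A^* * S^* + `|A| ^+ 2 * V.

Local Notation u := voltage_product.
Local Notation l := series_current_sq.

Lemma conj_voltage_product : u^* = Z * ((Y + A) * V - S^*).
Proof.
rewrite /voltage_product rmorphM /= conjCK rmorphB rmorphM /= conjCK.
by rewrite V_real.
Qed.

Lemma impedance_conj : Z^* = 1 / Y^*.
Proof. by rewrite rmorphM rmorph1 fmorphV. Qed.

Lemma conj_admittance_neq0 : Y^* != 0.
Proof. by rewrite fmorph_eq0. Qed.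

Lemma sending_flow_iff v : S = (Y + A)^* * V - Y^* * v <-> v = u.
Proof.
rewrite /voltage_product impedance_conj.
by split=> ->; field; rewrite ?Y0 conj_admittance_neq0.
Qed.

(** The right-hand side is |v_i / T - v_j|^2 with products of voltages replaced
    by the variables; the equivalence is the value of u + u^* in terms of S. *)
Lemma voltage_drop_iff :
  (1 + Z * A + Z^* * A^*) * V - W = (Z^* * S + Z * S^*) - `|Z| ^+ 2 * l
  <-> `|Z| ^+ 2 * l = V + W - u - u^*.
Proof.
set k := `|Z| ^+ 2 * l.
have uu : u + u^* = (2 + Z * A + Z^* * A^*) * V - (Z^* * S + Z * S^*).
  rewrite conj_voltage_product /voltage_product impedance_conj rmorphD.
  by field; rewrite ?Y0 conj_admittance_neq0.
have -> : V + W - u - u^* = V + W - (u + u^*) by ring.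
rewrite uu; split=> h; last by rewrite h; ring.
have -> : k = (Z^* * S + Z * S^*) - ((1 + Z * A + Z^* * A^*) * V - W).
  by rewrite h; ring.
by ring.
Qed.

(** Since Z |Y|^2 = Y^*, the balance turns the series loss Z l into
    Y^* (V + W - u^* - u); subtracting the sending flow, in which -Y^* u occurs,
    leaves only the term in u^*. *)
Lemma receiving_flow_iff :
  `|Z| ^+ 2 * l = V + W - u - u^* ->
  (S + S' = Z * l + A^* * V + B^* * W
   <-> S' = (Y + B)^* * W - Y^* * u^*).
Proof.
move=> balance.
have Zl : Z * l = Y^* * (V + W - u - u^*).
  rewrite -balance normCK impedance_conj.
  by field; rewrite ?Y0 conj_admittance_neq0.
have SE : S = (Y + A)^* * V - Y^* * u by apply/sending_flow_iff.
have -> : Z * l + A^* * V + B^* * W = S + ((Y + B)^* * W - Y^* * u^*).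
  by rewrite Zl [in RHS]SE !rmorphD; ring.
by split=> [/addrI|->].
Qed.

(** Eliminating W by the balance gives V W - |u|^2 = |Z|^2 V l - |V - u|^2, and
    V - u = Z^* (S - A^* V); the terms by which l differs from L then cancel
    against those by which |S - A^* V|^2 differs from |S|^2. *)
Lemma cone_gapE :
  `|Z| ^+ 2 * l = V + W - u - u^* ->
  V * W - `|u| ^+ 2 = `|Z| ^+ 2 * (V * L - `|S| ^+ 2).
Proof.
move=> balance.
have -> : W = `|Z| ^+ 2 * l - V + u + u^* by rewrite balance; ring.
rewrite /series_current_sq !normCK conj_voltage_product /voltage_product.
rewrite impedance_conj rmorphD.
by field; rewrite ?Y0 conj_admittance_neq0.
Qed.

Lemma cone_iff :
  `|Z| ^+ 2 * l = V + W - u - u^* ->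
  (`|S| ^+ 2 <= V * L) = (`|u| ^+ 2 <= V * W).
Proof.
move=> balance; rewrite -subr_ge0 -[RHS]subr_ge0 cone_gapE // pmulr_rge0 //.
by rewrite exprn_gt0 // normr_gt0 div1r invr_eq0.
Qed.

(** The solution L of the balance equation. *)
Definition current_sq : C :=
  `|Y| ^+ 2 * (V + W - u - u^*) + A * S + A^* * S^* - `|A| ^+ 2 * V.

Lemma current_sq_real : W^* = W -> current_sq \is Num.real.
Proof.
move=> W_real; apply/CrealP; rewrite /current_sq !normCK.
(* The expression is real for any value of u. *)
move: (u) => v.
rewrite !(rmorphB, rmorphD, rmorphM) /= !conjCK V_real W_real; ring.
Qed.

Lemma balance_iff_current_sq :
  `|Z| ^+ 2 * l = V + W - u - u^* <-> L = current_sq.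
Proof.
have nY0 : `|Y| != 0 by rewrite normr_eq0.
rewrite normf_div normr1 /current_sq; split=> [<-|LE].
  by rewrite /series_current_sq; field.
by rewrite /series_current_sq {}LE; field.
Qed.

End SingleLine.

Lemma tapped_real (C : numClosedFieldType) (w t : C) :
  w^* = w -> (w / `|t| ^+ 2)^* = w / `|t| ^+ 2.
Proof.
by move=> w_real; rewrite rmorphM fmorphV rmorphXn /= conj_normC w_real.
Qed.

(** * The line constraints of the two models *)

Section NetworkLine.
Local Open Scope complex_scope.
Variables (R : realType) (N : finType) (D : network R N).
Variables (x : shared_vars D) (e : line (lines D)).

(** This and soc_line are, by conversion, the conditions at a line in the
    feasibility predicates, made to depend on the shared variables and on the one
    entry of L or W attached to that line. *)
Definition cdf_line (Lij : R) : Prop :=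
  let Y := admittance e in
  let Z := impedance e in
  let T := transformer e in
  let Yc := charging (fwd e) in
  let Yc' := charging (bwd e) in
  let Vi := Wtap x e in
  let Wj := (W x (val e).2)%:C in
  let Sij := Sf x (fwd e) in
  let Sji := Sf x (bwd e) in
  let Lij := Lij%:C in
  [/\ angle_constraint e (Z^* * T * ((Y + Yc)^* * Vi - Sij)),
      Sij + Sji
      = Z * (Lij - Yc * Sij - Yc^* * Sij^* + `|Yc| ^+ 2 * Vi)
        + Yc^* * Vi + Yc'^* * Wj,
      (1 + Z * Yc + Z^* * Yc^*) * Vi - Wj
      = (Z^* * Sij + Z * Sij^*)
        - `|Z| ^+ 2 * (Lij - Yc * Sij - Yc^* * Sij^* + `|Yc| ^+ 2 * Vi) &
      `|Sij| ^+ 2 <= Vi * Lij].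

Definition soc_line (Wij : R[i]) : Prop :=
  let Y := admittance e in
  let T := transformer e in
  let Wi := (W x (val e).1)%:C in
  let Wj := (W x (val e).2)%:C in
  [/\ angle_constraint e Wij,
      Sf x (fwd e) = (Y + charging (fwd e))^* * Wtap x e - Y^* * (Wij / T),
      Sf x (bwd e) = (Y + charging (bwd e))^* * Wj - Y^* * (Wij^* / T^*) &
      `|Wij| ^+ 2 <= Wi * Wj].

Local Notation Y := (admittance e).
Local Notation T := (transformer e).
Local Notation A := (charging (fwd e)).
Local Notation S := (Sf x (fwd e)).
Local Notation V := (Wtap x e).
Local Notation Wj := ((W x (val e).2)%:C).
Local Notation u := (voltage_product Y A S V).

(** The value that the sending equation forces on W_ij, in the form in which it
    occurs in the angle constraint of the CDF model. *)
Definition line_product : R[i] :=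
  (impedance e)^* * T * ((Y + A)^* * V - S).

(** Taking the real part loses nothing, by current_sq_real. *)
Definition line_current_sq : R :=
  complex.Re (current_sq Y A S V Wj).

Lemma Wtap_real : V^* = V.
Proof. exact: (@tapped_real R[i] _ _ (conjc_real _)). Qed.

Lemma line_productE : line_product = T * u.
Proof. by rewrite /line_product mulrAC [RHS]mulrC. Qed.

Lemma current_balance_iff Lij :
  `|1 / Y| ^+ 2 * series_current_sq A S V Lij%:C = V + Wj - u - u^*
  <-> Lij = line_current_sq.
Proof.
rewrite (balance_iff_current_sq _ _ _ _ _ (admittance_neq0 e)).
have -> : current_sq Y A S V Wj = line_current_sq%:C.
  apply/esym/RRe_real/current_sq_real; first exact: Wtap_real.
  exact: conjc_real.
by split=> [[]|->].
Qed.

(** Uniqueness of W_ij: it gives surjectivity of the map below. *)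
Lemma soc_line_product Wij : soc_line Wij -> Wij = line_product.
Proof.
case=> _ SE _ _; rewrite line_productE.
have /(sending_flow_iff _ _ _ (admittance_neq0 e)) <- := SE.
by rewrite mulrC divfK // transformer_neq0.
Qed.

(** Both models read on one line. The value of L carries no condition besides
    the balance equation, so that L is recovered from the shared variables; this
    gives both injectivity and the inverse of the map below. *)
Lemma cdf_line_iff Lij :
  cdf_line Lij <-> soc_line line_product /\ Lij = line_current_sq.
Proof.
have Y0 := admittance_neq0 e; have T0 := transformer_neq0 e.
have dropE := voltage_drop_iff A S Wj Lij%:C Y0 Wtap_real.
have recvE := @receiving_flow_iff _ Y A (charging (bwd e)) S (Sf x (bwd e))
  V Wj Lij%:C Y0.
have wT : line_product / T = u by rewrite line_productE mulrC mulKf.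
have wTc : line_product^* / T^* = u^*.
  by rewrite -wT -conjc_inv; apply/esym/rmorphM.
have coneE : (`|line_product| ^+ 2 <= (W x (val e).1)%:C * Wj)
    = (`|u| ^+ 2 <= V * Wj).
  have T2 : 0 < `|T| ^+ 2 by rewrite exprn_gt0 // normr_gt0.
  have -> : (W x (val e).1)%:C = `|T| ^+ 2 * V.
    by rewrite /Wtap mulrCA divff ?mulr1 // gt_eqF.
  by rewrite line_productE normrM exprMn -[leRHS]mulrA ler_pM2l.
rewrite /soc_line wT wTc coneE; split.
  case=> angle loss /dropE balance cone; split; last exact/current_balance_iff.
  split=> //.
  - exact: (proj2 (sending_flow_iff A S V Y0 _) erefl).
  - exact: (proj1 (recvE balance) loss).
  - by rewrite -(cone_iff Y0 Wtap_real balance).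
case=> -[angle _ recv cone] /current_balance_iff balance; split=> //.
- exact: (proj2 (recvE balance) recv).
- exact/dropE.
- by rewrite (cone_iff Y0 Wtap_real balance).
Qed.

End NetworkLine.

(** * The bijection *)

Theorem theorem5p1 (R : realType) (N : finType) (D : network R N) :
  exists f : cdf_vars D -> soc_vars D,
    set_bij (@cdf_feasible R N D) (@soc_feasible R N D) f /\
    forall p, cdf_feasible p -> soc_shared (f p) = cdf_shared p.
Proof.
exists (fun p => SocVars (cdf_shared p) [ffun e => line_product (cdf_shared p) e]).
split=> //; split.
- move=> p [shared linesP]; split=> // e; rewrite /= ffunE.
  by have /cdf_line_iff[] := linesP e.
- move=> [x l] [x' l']; rewrite !in_setE => -[_ linesP] [_ linesP'] [xx' _].
  case: x' / xx' in linesP' *; congr CdfVars; apply/ffunP=> e.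
  have /cdf_line_iff[_ ->] := linesP e.
  by have /cdf_line_iff[_ ->] := linesP' e.
- move=> [x w] [shared linesP].
  exists (CdfVars x [ffun e => line_current_sq x e]).
    split=> // e; rewrite /= ffunE; apply/cdf_line_iff; split=> //.
    by rewrite -(soc_line_product (linesP e)); apply: linesP.
  congr SocVars; apply/ffunP=> e; rewrite ffunE.
  by rewrite -(soc_line_product (linesP e)).
Qed.
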